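(* Let the grid $a=t_0<t_1<\dots<t_n=b$ be equidistant with stepsize $h$, and let $\mathcal{C}$ be the constraint matrix defined in the context with respect to the chosen basis. Then: \begin{itemize} \item for the Legendre basis, $\kappa(\mathcal{C})\le\sqrt5$ and $\|\mathcal{C}^+\|\le h^{-1}$; \item for the modified Legendre basis, $\kappa(\mathcal{C})\le\left(\frac{2N+6}{2N}\right)^{1/2}$ and $\|\mathcal{C}^+\|\le(2N)^{-1/2}h^{-1}$; \item for the Chebyshev basis, $\kappa(\mathcal{C})\le(4+2\ln2)^{1/2}$ and $\|\mathcal{C}^+\|\le h^{-1}$; \item for the Runge–Kutta basis, $\kappa(\mathcal{C})\le(5N)^{1/2}$ and $\|\mathcal{C}^+\|\le N^{1/2}h^{-1}$, provided that $\int_0^1p_i(\sigma)\,d\sigma\ge0$ for $i=0,1,\dots,N-1$. \end{itemize}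
   Context: $k<m$ are positive integers, $N\ge1$, $n\ge2$ integers; $h_j=t_j-t_{j-1}$ ($=h$ for an equidistant grid). $\|\cdot\|$ is the spectral norm, $\mathcal{C}^+$ the Moore–Penrose inverse, $\kappa(\mathcal{C})=\|\mathcal{C}\|\,\|\mathcal{C}^+\|$. Given a basis $\{p_0,\dots,p_{N-1}\}$ of the polynomials of degree $\le N-1$ on $[0,1]$, let $\bar p_0=1$, $\bar p_i(\tau)=\int_0^\tau p_{i-1}(\sigma)d\sigma$ ($i=1,\dots,N$), and $\bar p_{ji}(t)=h_j\bar p_i((t-t_{j-1})/h_j)$. Vectors $c\in\mathbb{R}^{n(mN+k)}$ have entries $c_{j\kappa l}$ ordered lexicographically by $j=1,\dots,n$, $\kappa=1,\dots,m$, and $l=0,\dots,N$ if $\kappa\le k$, $l=0,\dots,N-1$ if $\kappa>k$. The constraint matrix $\mathcal{C}\in\mathbb{R}^{k(n-1)\times n(mN+k)}$ is defined by $(\mathcal{C}c)_{(j,\kappa)}=\sum_{l=0}^Nc_{j\kappa l}\bar p_{jl}(t_j)-\sum_{l=0}^Nc_{j+1,\kappa,l}\bar p_{j+1,l}(t_j)$, $j=1,\dots,n-1$ (outer index), $\kappa=1,\dots,k$ (inner index); it has full row rank. Bases: Legendre basis: $p_i(\tau)=P_i(2\tau-1)$, with $P_i$ the Legendre polynomials (normalized by $P_i(1)=1$). Modified Legendre basis: $\bar p_0=1$, $\bar p_i(\tau)=P_i(2\tau-1)-(-1)^i$ for $i\ge1$, i.e. $p_i=\bar p_{i+1}'$.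 Chebyshev basis: $p_i(\tau)=T_i(2\tau-1)$, with $T_i$ the Chebyshev polynomials of the first kind. Runge–Kutta basis: for nodes $0<\tau_1<\dots<\tau_N<1$, $p_i(\tau)=\prod_{\kappa\ne i+1}\frac{\tau-\tau_\kappa}{\tau_{i+1}-\tau_\kappa}$, $i=0,\dots,N-1$. *)

(* Defs.v *)
From HB Require Import structures.
From mathcomp Require Import all_boot all_order all_algebra.
From mathcomp Require Import all_classical all_reals all_analysis.
From mathcomp Require Import zify ring.

Set Implicit Arguments.
Unset Strict Implicit.
Unset Printing Implicit Defensive.

Import Order.TTheory GRing.Theory Num.Theory.
Import numFieldNormedType.Exports.

Local Open Scope classical_set_scope.
Local Open Scope ring_scope.

(* The matrix norm is the one induced by the Euclidean vector norm. The
   library norm on matrices is the maximum norm, which is not the one meant. *)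
Definition enorm (R : realType) (p : nat) (x : 'cV[R]_p) : R :=
  Num.sqrt (\sum_(i < p) x i 0 ^+ 2).

Definition spectral_norm (R : realType) (p q : nat) (A : 'M[R]_(p, q)) : R :=
  sup [set enorm (A *m x) | x in [set x : 'cV[R]_q | enorm x <= 1]].

Lemma spectral_norm_has_sup (R : realType) (p q : nat) (A : 'M[R]_(p, q)) :
  has_sup [set enorm (A *m x) | x in [set x : 'cV[R]_q | enorm x <= 1]].
Proof.
split.
  exists (enorm (A *m 0)), 0 => //=; rewrite /enorm big1 ?sqrtr0 ?ler01 //.
  by move=> i _; rewrite mxE expr0n.
exists (Num.sqrt (\sum_i (\sum_j `|A i j|) ^+ 2)) => _ [x /= hx <-].
apply: ler_wsqrtr; apply: ler_sum => i _.
have xj (j : 'I_q) : `|x j 0| <= 1.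
  rewrite -sqrtr_sqr (le_trans _ hx) //; apply: ler_wsqrtr.
  by rewrite (bigD1 j) //= lerDl sumr_ge0 // => *; rewrite sqr_ge0.
rewrite -real_normK ?num_real // lerXn2r ?nnegrE ?normr_ge0 ?sumr_ge0 //.
rewrite mxE (le_trans (ler_norm_sum _ _ _)) //; apply: ler_sum => j _.
by rewrite normrM ler_piMr.
Qed.

(* The four Penrose conditions. [pinvmx] in mxalgebra is only some generalized
   inverse, not the Moore-Penrose inverse. *)
Definition is_moore_penrose (R : realType) (p q : nat)
    (A : 'M[R]_(p, q)) (B : 'M[R]_(q, p)) : Prop :=
  [/\ A *m B *m A = A, B *m A *m B = B,
      (A *m B)^T = A *m B & (B *m A)^T = B *m A].

Definition moore_penrose (R : realType) (p q : nat) (A : 'M[R]_(p, q)) :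
  'M[R]_(q, p) := xget 0 [set B | is_moore_penrose A B].

Lemma gram_unitmx (R : realType) (p q : nat) (A : 'M[R]_(p, q)) :
  row_free A -> A *m A^T \in unitmx.
Proof.
move=> fA; rewrite -row_free_unit -kermx_eq0; apply/eqP/row_matrixP => i.
rewrite row0; set v := row i _.
have vG : v *m (A *m A^T) = 0.
  by apply/sub_kermxP; rewrite row_sub.
have wwT : (v *m A) *m (v *m A)^T = 0.
  by rewrite trmx_mul mulmxA -(mulmxA v) vG mul0mx.
have w0 : v *m A = 0.
  apply/rowP => j; rewrite [RHS]mxE; move/matrixP/(_ 0 0): wwT.
  rewrite [LHS]mxE [RHS]mxE => /eqP.
  rewrite psumr_eq0 => [/allP/(_ j)|k _].
    by rewrite mem_index_enum [_^T j 0]mxE -expr2 sqrf_eq0 => /(_ isT)/eqP.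
  by rewrite [_^T k 0]mxE -expr2 sqr_ge0.
by apply: (row_free_inj fA); rewrite w0 mul0mx.
Qed.

Lemma moore_penroseP (R : realType) (p q : nat) (A : 'M[R]_(p, q)) :
  is_moore_penrose A (moore_penrose A).
Proof.
have full_rank r (B : 'M[R]_(p, r)) (C : 'M[R]_(r, q)) :
    row_full B -> row_free C -> exists D, is_moore_penrose (B *m C) D.
  move=> fB fC; have uC := gram_unitmx fC.
  have uB : B^T *m B \in unitmx.
    rewrite -{2}[B]trmxK; apply: gram_unitmx.
    by rewrite /row_free mxrank_tr; exact: fB.
  have [X CX XC] : exists2 X, C *m X = 1%:M & (X *m C)^T = X *m C.
    exists (C^T *m invmx (C *m C^T)); first by rewrite mulmxA mulmxV.
    by rewrite !trmx_mul trmxK trmx_inv trmx_mul trmxK mulmxA.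
  have [Y YB BY] : exists2 Y, Y *m B = 1%:M & (B *m Y)^T = B *m Y.
    exists (invmx (B^T *m B) *m B^T); first by rewrite -mulmxA mulVmx.
    by rewrite !trmx_mul trmxK trmx_inv trmx_mul trmxK mulmxA.
  have BCXY : B *m C *m (X *m Y) = B *m Y.
    by rewrite !mulmxA -(mulmxA B C) CX mulmx1.
  have XYBC : X *m Y *m (B *m C) = X *m C.
    by rewrite !mulmxA -(mulmxA X Y) YB mulmx1.
  exists (X *m Y); split.
  - by rewrite BCXY !mulmxA -(mulmxA B Y) YB mulmx1.
  - by rewrite XYBC !mulmxA -(mulmxA X C) CX mulmx1.
  - by rewrite BCXY.
  - by rewrite XYBC.
have [D hD] := full_rank _ _ _ (col_base_full A) (row_base_free A).
rewrite mulmx_base in hD.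
by rewrite /moore_penrose; case: xgetP => [B _ //|/(_ D)].
Qed.

Lemma moore_penrose_uniq (R : realType) (p q : nat) (A : 'M[R]_(p, q))
  (B C : 'M[R]_(q, p)) :
  is_moore_penrose A B -> is_moore_penrose A C -> B = C.
Proof.
move=> [b1 b2 b3 b4] [c1 c2 c3 c4].
have AB : A *m B = A *m C.
  rewrite -b3 -{1}c1 -(mulmxA (A *m C)) trmx_mul b3 c3.
  by rewrite mulmxA b1.
have BA : B *m A = C *m A.
  rewrite -b4 -{1}c1 -(mulmxA A C A) mulmxA trmx_mul b4 c4.
  by rewrite -mulmxA (mulmxA A) b1.
by rewrite -b2 -mulmxA AB mulmxA BA c2.
Qed.

Definition cond_number (R : realType) (p q : nat) (A : 'M[R]_(p, q)) : R :=
  spectral_norm A * spectral_norm (moore_penrose A).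

(* pbar_0 = 1 and pbar_i(tau) is the integral of p_(i-1) over [0, tau]. *)
Definition pbar (R : realType) (N : nat) (p : 'I_N -> {poly R})
    (i : 'I_N.+1) (tau : R) : R :=
  if unlift ord0 i is Some i' then
    \int[lebesgue_measure]_(s in `[0, tau]) (p i').[s]
  else 1.

(* Subintervals are numbered from 0: the j-th one is [t j, t j.+1], and only
   the values t 0, ..., t n of a grid matter. *)
Definition stepsize (R : realType) (t : nat -> R) (j : nat) : R :=
  t j.+1 - t j.

Definition pbar_sub (R : realType) (N : nat) (t : nat -> R)
    (p : 'I_N -> {poly R}) (j : nat) (l : 'I_N.+1) (x : R) : R :=
  stepsize t j * pbar p l ((x - t j) / stepsize t j).

(* Position of the coefficient (j, kap, l), all numbered from 0, in the
   lexicographic order: a subinterval owns m * N + k coefficients; the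
   component kap owns N + 1 of them if kap < k, and N otherwise. *)
Definition coef_idx (k m N j kap l : nat) : nat :=
  j * (m * N + k) + (kap * N + minn kap k) + l.

Lemma coef_idx_lt (k m N n j kap l : nat) :
  (j < n -> kap < m -> l < N + (kap < k)%N ->
   coef_idx k m N j kap l < n * (m * N + k))%N.
Proof.
move=> jn km lN; apply: (@leq_trans (j.+1 * (m * N + k))%N); last first.
  by rewrite leq_mul2r jn orbT.
rewrite /coef_idx mulSn [ltnRHS]addnC -addnA ltn_add2l.
have : (kap.+1 * N <= m * N)%N by rewrite leq_mul2r km orbT.
rewrite mulSn; move: lN; case: (ltnP kap k); lia.
Qed.

(* The default 0 is never reached in the ranges of [coef_idx_lt]. *)
Definition coef (R : realType) (k m N n : nat) (c : 'cV[R]_(n * (m * N + k)))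
    (j kap l : nat) : R :=
  if insub (coef_idx k m N j kap l) is Some q then c q 0 else 0.

(* The entry r = j * k + kap is the jump of component kap at t j.+1. *)
Definition constraint_map (R : realType) (k m N n : nat) (t : nat -> R)
    (p : 'I_N -> {poly R}) (c : 'cV[R]_(n * (m * N + k))) :
    'cV[R]_(k * (n - 1)) :=
  \col_(r < k * (n - 1))
    let j := (r %/ k)%N in
    let kap := (r %% k)%N in
    \sum_(l < N.+1) coef c j kap l * pbar_sub t p j l (t j.+1)
    - \sum_(l < N.+1) coef c j.+1 kap l * pbar_sub t p j.+1 l (t j.+1).

Definition constraint_mx (R : realType) (k m N n : nat) (t : nat -> R)
    (p : 'I_N -> {poly R}) : 'M[R]_(k * (n - 1), n * (m * N + k)) :=
  \matrix_(r, q) constraint_map t p (delta_mx q 0) r 0.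

Lemma constraint_mxE (R : realType) (k m N n : nat) (t : nat -> R)
    (p : 'I_N -> {poly R}) (c : 'cV[R]_(n * (m * N + k))) :
  constraint_mx k m n t p *m c = constraint_map t p c.
Proof.
have coefE j kap l :
    coef c j kap l = \sum_q coef (delta_mx q 0) j kap l * c q 0.
  rewrite /coef; case: insubP => [q' _ _|_]; last first.
    by rewrite big1 // => q _; rewrite mul0r.
  rewrite (bigD1 q') //= mxE !eqxx mul1r big1 ?addr0 // => q /negPf nq.
  by rewrite mxE eq_sym nq mul0r.
apply/colP => r; rewrite !mxE.
under eq_bigr do rewrite !mxE mulrBl !mulr_suml.
rewrite sumrB; congr (_ - _); rewrite exchange_big; apply: eq_bigr => l _.
  by rewrite [in RHS]coefE mulr_suml; apply: eq_bigr => q _; rewrite mulrAC.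
by rewrite [in RHS]coefE mulr_suml; apply: eq_bigr => q _; rewrite mulrAC.
Qed.

(* Rodrigues' formula. *)
Definition legendre (R : realType) (i : nat) : {poly R} :=
  (2 ^+ i * i`!%:R)^-1 *: (('X ^+ 2 - 1) ^+ i)^`(i).

Lemma legendre_at1 (R : realType) (i : nat) : (legendre R i).[1] = 1.
Proof.
have H (n : nat) (q : {poly R}) :
    ((('X - 1) ^+ n * q)^`(n)).[1] = n`!%:R * q.[1].
  elim: n q => [|n IHn] q; first by rewrite derivn0 expr0 !mul1r.
  rewrite derivSn.
  have -> : (('X - 1) ^+ n.+1 * q)^`() =
            ('X - 1) ^+ n * (q *+ n.+1 + ('X - 1) * q^`()).
    rewrite derivM deriv_exp /= derivB derivX derivC subr0 mul1r exprS.
    by rewrite mulrnAl -mulrnAr; ring.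
  by rewrite IHn !hornerE hornerMn factS natrM -mulr_natr; ring.
have X21 : 'X ^+ 2 - 1 = ('X - 1) * ('X + 1) :> {poly R} by ring.
rewrite /legendre X21 exprMn hornerZ H horner_exp !hornerE.
by rewrite /= -mulrA [2 ^+ i * _]mulrC mulVf // mulf_neq0 ?expf_neq0
  ?pnatr_eq0 -?lt0n ?fact_gt0.
Qed.

Fixpoint chebyshev (R : realType) (i : nat) : {poly R} :=
  match i with
  | 0%N => 1
  | 1%N => 'X
  | (i'.+1 as i1).+1 => 2%:R *: ('X * chebyshev R i1) - chebyshev R i'
  end.

Lemma chebyshev_cos (R : realType) (i : nat) (x : R) :
  (chebyshev R i).[cos x] = cos (i%:R * x).
Proof.
suff: (chebyshev R i).[cos x] = cos (i%:R * x) /\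
      (chebyshev R i.+1).[cos x] = cos (i.+1%:R * x) by case.
elim: i => [|i [IH0 IH1]].
  by rewrite /= hornerC hornerX mul0r cos0 mul1r.
split=> //.
have -> : chebyshev R i.+2 = 2%:R *: ('X * chebyshev R i.+1) - chebyshev R i.
  by [].
rewrite !hornerE IH0 IH1.
have -> : i.+2%:R * x = i.+1%:R * x + x by rewrite -[in LHS]natr1 mulrDl mul1r.
have -> : i%:R * x = i.+1%:R * x - x by rewrite -[in RHS]natr1; ring.
rewrite !cosD cosN sinN /=; ring.
Qed.

(* 2 tau - 1 as a polynomial in tau. *)
Definition shift01 (R : realType) : {poly R} := 2%:R *: 'X - 1.

Definition legendre_basis (R : realType) (N : nat) (i : 'I_N) : {poly R} :=
  legendre R i \Po shift01 R.

(* p_i = pbar_(i+1)', where pbar_i(tau) = P_i(2 tau - 1) - (-1)^i. *)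
Definition modified_legendre_basis (R : realType) (N : nat) (i : 'I_N) :
    {poly R} :=
  (legendre R i.+1 \Po shift01 R - ((-1) ^+ i.+1)%:P)^`().

Definition chebyshev_basis (R : realType) (N : nat) (i : 'I_N) : {poly R} :=
  chebyshev R i \Po shift01 R.

Definition runge_kutta_basis (R : realType) (N : nat) (tau : 'I_N -> R)
    (i : 'I_N) : {poly R} :=
  \prod_(kap < N | kap != i) ((tau i - tau kap)^-1 *: ('X - (tau kap)%:P)).

(* Main.v *)
(* Up to the factor h, the rows of the constraint matrix C are those of
   W + F - E, where F and E select the coefficients (j, kappa, 0) and
   (j + 1, kappa, 0), and W carries the values pbar_l(1), l >= 1. The rows of W
   are orthogonal to each other and to those of F and E, so with
   s = sum_(l >= 1) pbar_l(1)^2,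
     |C^T y|^2 = h^2 (s |y|^2 + |(F - E)^T y|^2).
   As F and E have orthonormal rows, the last term is between 0 and 4 |y|^2 by
   the parallelogram law. Hence |C|^2 <= h^2 (s + 4), |C^+|^2 <= 1 / (h^2 s) and
   kappa(C)^2 <= 1 + 4 / s, and a lower bound on s settles each basis. *)
Require Import Defs.
From HB Require Import structures.
From mathcomp Require Import all_boot all_order all_algebra.
From mathcomp Require Import all_classical all_reals all_analysis.
From mathcomp Require Import zify ring lra.

Import Order.TTheory GRing.Theory Num.Theory.
Import numFieldNormedType.Exports.

Local Open Scope classical_set_scope.
Local Open Scope ring_scope.

Set Implicit Arguments.
Unset Strict Implicit.

(** * Squared Euclidean norms and the resulting spectral bounds *)

Definition sqnorm (R : realType) (p : nat) (x : 'cV[R]_p) : R :=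
  (x^T *m x) 0 0.

Lemma dotmxE (R : realType) (p : nat) (x y : 'cV[R]_p) :
  (x^T *m y) 0 0 = \sum_i x i 0 * y i 0.
Proof. by rewrite mxE; apply: eq_bigr => i _; rewrite mxE. Qed.

Lemma sqnorm_ge0 (R : realType) (p : nat) (x : 'cV[R]_p) : 0 <= sqnorm x.
Proof.
by rewrite /sqnorm dotmxE sumr_ge0 // => i _; rewrite -expr2 sqr_ge0.
Qed.

Lemma enormE (R : realType) (p : nat) (x : 'cV[R]_p) :
  enorm x = Num.sqrt (sqnorm x).
Proof.
by rewrite /enorm /sqnorm dotmxE; under [in RHS]eq_bigr do rewrite -expr2.
Qed.

Lemma sqnorm_le0 (R : realType) (p : nat) (x : 'cV[R]_p) :
  sqnorm x <= 0 -> x = 0.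
Proof.
move=> x0; have /eqP : sqnorm x = 0 by apply: le_anti; rewrite x0 sqnorm_ge0.
rewrite /sqnorm dotmxE psumr_eq0 => [/allP xi|i _]; last first.
  by rewrite -expr2 sqr_ge0.
apply/colP => i; rewrite mxE; apply/eqP; rewrite -sqrf_eq0 expr2.
exact: (xi i (mem_index_enum i)).
Qed.

Lemma sqnormZ (R : realType) (p : nat) (c : R) (x : 'cV[R]_p) :
  sqnorm (c *: x) = c ^+ 2 * sqnorm x.
Proof.
rewrite /sqnorm !dotmxE mulr_sumr; apply: eq_bigr => i _.
by rewrite !mxE; ring.
Qed.

Lemma sqnormD (R : realType) (p : nat) (x y : 'cV[R]_p) :
  sqnorm (x + y) = sqnorm x + 2 * (x^T *m y) 0 0 + sqnorm y.
Proof.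
rewrite /sqnorm !dotmxE mulr_sumr -!big_split /=; apply: eq_bigr => i _.
by rewrite !mxE; ring.
Qed.

Lemma sqnormBZ (R : realType) (p : nat) (c : R) (x y : 'cV[R]_p) :
  sqnorm (x - c *: y) = sqnorm x - 2 * c * (x^T *m y) 0 0 + c ^+ 2 * sqnorm y.
Proof.
by rewrite -scaleNr sqnormD sqnormZ -scalemxAr mxE; ring.
Qed.

Lemma sqnorm_parallelogram (R : realType) (p : nat) (x y : 'cV[R]_p) :
  sqnorm (x - y) + sqnorm (x + y) = 2 * (sqnorm x + sqnorm y).
Proof. by rewrite -[y in x - y]scale1r sqnormBZ sqnormD; ring. Qed.

Lemma sqnorm_tr_mulmx (R : realType) (p q : nat) (A : 'M[R]_(p, q))
    (s : R) (y : 'cV[R]_p) :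
  A *m A^T = s%:M -> sqnorm (A^T *m y) = s * sqnorm y.
Proof.
move=> AA; rewrite /sqnorm trmx_mul trmxK mulmxA -(mulmxA _ A) AA.
by rewrite mul_mx_scalar -scalemxAl mxE.
Qed.

Lemma sqnorm_mulmx_le (R : realType) (p q : nat) (A : 'M[R]_(p, q)) (c : R) :
  0 < c -> (forall y, sqnorm (A^T *m y) <= c * sqnorm y) ->
  forall x, sqnorm (A *m x) <= c * sqnorm x.
Proof.
(* Expand [0 <= |A^T A x - c x|^2]. *)
move=> c0 Ac x.
have := sqnorm_ge0 (A^T *m (A *m x) - c *: x); rewrite sqnormBZ.
have -> : ((A^T *m (A *m x))^T *m x) 0 0 = sqnorm (A *m x).
  by rewrite /sqnorm trmx_mul trmxK -mulmxA.
have := Ac (A *m x); nra.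
Qed.

(** The lower bound makes [A^T] injective, so the Moore-Penrose inverse [B] is a right inverse of
    [A]. As [B y] lies in the range of [A^T], the lower bound applies to a preimage of it. *)
Lemma sqnorm_moore_penrose_le (R : realType) (p q : nat) (A : 'M[R]_(p, q))
    (c : R) :
  0 < c -> (forall y, c * sqnorm y <= sqnorm (A^T *m y)) ->
  forall y, sqnorm (moore_penrose A *m y) <= c^-1 * sqnorm y.
Proof.
move=> c0 Ac y; have [ABA BAB ABT BAT] := moore_penroseP A.
set B := moore_penrose A in ABA BAB ABT BAT *.
have inj (z : 'cV_p) : A^T *m z = 0 -> z = 0.
  move=> Az0; apply: sqnorm_le0; have := Ac z.
  by rewrite Az0 {2}/sqnorm mulmx0 mxE pmulr_rle0.
(* [A^T (A B) = (A B A)^T = A^T] by the symmetry of [A B], and [A^T] is injective. *)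
have ABy : A *m (B *m y) = y.
  apply/eqP; rewrite mulmxA -subr_eq0; apply/eqP/inj.
  by rewrite mulmxBr -ABT mulmxA -trmx_mul ABA subrr.
(* From [B = (B A) B = (B A)^T B = A^T B^T B]: this [w] is a preimage of [B y] under [A^T]. *)
pose w := B^T *m (B *m y).
have Byw : B *m y = A^T *m w.
  by rewrite /w !mulmxA -trmx_mul BAT BAB.
have yw : (y^T *m w) 0 0 = sqnorm (B *m y).
  by rewrite /w mulmxA -trmx_mul.
(* [0 <= |y - c w|^2 = |y|^2 - 2 c |B y|^2 + c^2 |w|^2], where
   [c |w|^2 <= |B y|^2]. *)
have := sqnorm_ge0 (y - c *: w); rewrite sqnormBZ yw.
have := Ac w; rewrite -Byw => cw.
by rewrite ler_pdivlMl //; nra.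
Qed.

Lemma spectral_norm_le (R : realType) (p q : nat) (A : 'M[R]_(p, q)) (c : R) :
  0 <= c -> (forall x, sqnorm (A *m x) <= c * sqnorm x) ->
  spectral_norm A <= Num.sqrt c.
Proof.
move=> c0 Ac; apply: ge_sup; first by case: (spectral_norm_has_sup A).
move=> _ [x /= x1 <-]; rewrite enormE ler_wsqrtr // (le_trans (Ac x)) //.
by rewrite ler_piMr //; move: x1; rewrite enormE -{1}sqrtr1 ler_sqrt.
Qed.

Lemma spectral_norm_ge0 (R : realType) (p q : nat) (A : 'M[R]_(p, q)) :
  0 <= spectral_norm A.
Proof.
apply: (le_trans (sqrtr_ge0 _)); apply: (ub_le_sup (spectral_norm_has_sup A).2).
by exists 0; rewrite //= enormE /sqnorm mulmx0 mxE sqrtr0.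
Qed.

(** The upper estimate bounds the norm of [A], the lower one that of its Moore-Penrose inverse. In
    the product [h] cancels, leaving [1 + 4 / s], which decreases in [s]; hence [s0] may replace
    [s]. *)
Lemma cond_number_bounds (R : realType) (p q : nat) (A : 'M[R]_(p, q))
    (h s s0 : R) :
  0 < h -> 0 < s0 <= s ->
  (forall y, h ^+ 2 * s * sqnorm y <= sqnorm (A^T *m y) <=
             h ^+ 2 * (s + 4) * sqnorm y) ->
  cond_number A <= Num.sqrt (1 + 4 / s0) /\
  spectral_norm (moore_penrose A) <= Num.sqrt s0^-1 * h^-1.
Proof.
move=> h0 /andP[s00 s0s] Ah; have sp := lt_le_trans s00 s0s.
have h20 : 0 < h ^+ 2 by rewrite exprn_gt0.
have hs0 : 0 < h ^+ 2 * s by rewrite mulr_gt0.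
have hs40 : 0 < h ^+ 2 * (s + 4) by rewrite mulr_gt0 ?addr_gt0.
have nA : spectral_norm A <= Num.sqrt (h ^+ 2 * (s + 4)).
  apply: spectral_norm_le; first exact: ltW.
  by apply: sqnorm_mulmx_le => // y; case/andP: (Ah y).
have nB : spectral_norm (moore_penrose A) <= Num.sqrt (h ^+ 2 * s)^-1.
  apply: spectral_norm_le; first by rewrite invr_ge0 ltW.
  by apply: sqnorm_moore_penrose_le => // y; case/andP: (Ah y).
split.
  apply: le_trans (ler_pM (spectral_norm_ge0 _) (spectral_norm_ge0 _) nA nB) _.
  rewrite -sqrtrM ?(ltW hs40) // ler_wsqrtr //.
  have -> : h ^+ 2 * (s + 4) / (h ^+ 2 * s) = 1 + 4 / s.
    by field; rewrite !gt_eqF.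
  by rewrite lerD2l ler_pM2l // lef_pV2.
apply: le_trans nB _.
rewrite invfM mulrC -exprVn sqrtrM ?invr_ge0 ?(ltW sp) //.
rewrite sqrtr_sqr ger0_norm ?invr_ge0 ?(ltW h0) //.
by rewrite ler_pM2r ?invr_gt0 // ler_wsqrtr // lef_pV2.
Qed.

(** * Selection matrices and the structure of the constraint matrix *)

Definition select_mx (R : realType) (p q : nat) (f : nat -> nat) :
  'M[R]_(p, q) := \matrix_(r, c) (f r == c :> nat)%:R.

Lemma select_mx_mul_tr (R : realType) (p q : nat) (f g : nat -> nat)
    (r r' : 'I_p) :
  (f r < q)%N ->
  (select_mx R p q f *m (select_mx R p q g)^T) r r' = (f r == g r')%:R.
Proof.
move=> fr; rewrite mxE (bigD1 (Ordinal fr)) //= !mxE eqxx mul1r.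
rewrite big1 ?addr0 /= => [|i]; first by rewrite eq_sym.
by rewrite !mxE -val_eqE /= eq_sym => /negPf ->; rewrite mul0r.
Qed.

Lemma coef_delta (R : realType) (k m N n j kap l : nat)
    (q : 'I_(n * (m * N + k))) :
  coef (delta_mx q 0 : 'cV[R]__) j kap l =
  (coef_idx k m N j kap l == q :> nat)%:R.
Proof.
rewrite /coef; case: insubP => [q' _ <-|]; first by rewrite mxE andbT.
by case: eqP => // ->; rewrite ltn_ord.
Qed.

Lemma euclid_uniq (d q q' r r' : nat) : (r < d)%N -> (r' < d)%N ->
  (q * d + r = q' * d + r')%N -> q = q' /\ r = r'.
Proof.
move=> rd r'd e; have d0 : (0 < d)%N by lia.
have := congr1 (divn^~ d) e; have := congr1 (modn^~ d) e.
by rewrite /= !divnMDl // !modnMDl !divn_small // !modn_small // !addn0.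
Qed.

(** For [kap < k] each component owns [N + 1] coefficients, so the index is a mixed-radix number
    with digits [j], [kap], [l]; uniqueness of Euclidean division is applied twice. *)
Lemma coef_idx_inj (k m N j kap l j' kap' l' : nat) :
  (k <= m)%N -> (kap < k)%N -> (kap' < k)%N -> (l <= N)%N -> (l' <= N)%N ->
  coef_idx k m N j kap l = coef_idx k m N j' kap' l' ->
  [/\ j = j', kap = kap' & l = l'].
Proof.
move=> km kk kk' lN lN'.
have E jj ka ll : (ka < k)%N ->
    coef_idx k m N jj ka ll = (jj * (m * N + k) + (ka * N.+1 + ll))%N.
  by move=> kak; rewrite /coef_idx (minn_idPl (ltnW kak)) mulnS; lia.
have B ka ll : (ka < k)%N -> (ll <= N)%N -> (ka * N.+1 + ll < m * N + k)%N.
  by move=> ? ?; nia.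
rewrite !E // => /euclid_uniq [|| -> ]; try exact: B.
by move/euclid_uniq => [||-> ->]; rewrite ?ltnS.
Qed.

Lemma pbar_at0 (R : realType) (N : nat) (p : 'I_N -> {poly R}) (i : 'I_N.+1) :
  pbar p i 0 = (i == ord0)%:R.
Proof.
rewrite /pbar; case: unliftP => [i' -> | ->]; last by rewrite eqxx.
by rewrite set_itv1 Rintegral_set1 -[in RHS]val_eqE.
Qed.

(** The quantity [s] of the overview: summand [i] is the square of the value of pbar with index
    [i + 1] at 1. *)
Definition pbar_sqsum (R : realType) (N : nat) (p : 'I_N -> {poly R}) : R :=
  \sum_(i < N) (\int[lebesgue_measure]_(s in `[0, 1]) (p i).[s]) ^+ 2.

Section ConstraintMatrix.

Variables (R : realType) (k m N n : nat) (h : R) (t : nat -> R).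
Variable (p : 'I_N -> {poly R}).
Hypothesis (kP : (0 < k)%N) (km : (k < m)%N) (hP : 0 < h).
Hypothesis hequi : forall j : nat, (j < n)%N -> stepsize t j = h.

(* The row [r = j * k + kap] has [j = r %/ k] and [kap = r %% k]; [idx d l r] is
   the column of the coefficient [(j + d, kap, l)]. *)
Let idx (d l r : nat) := coef_idx k m N (r %/ k + d) (r %% k) l.

Let M (f : nat -> nat) : 'M[R]_(k * (n - 1), n * (m * N + k)) :=
  select_mx R _ _ f.

Let row_lt (r : 'I_(k * (n - 1))) : (r %/ k + 1 < n)%N.
Proof.
by rewrite addnC -ltn_subRL ltn_divLR // [(_ * k)%N]mulnC ltn_ord.
Qed.

Let idx_lt (d l : nat) (r : 'I_(k * (n - 1))) :
  (d <= 1)%N -> (l <= N)%N -> (idx d l r < n * (m * N + k))%N.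
Proof.
move=> d1 lN; have rk : (r %% k < k)%N by rewrite ltn_mod.
by apply: coef_idx_lt; [have := row_lt r | | rewrite rk]; lia.
Qed.

(** Moving on by one subinterval amounts to moving on by [k] rows, so the pair [(j + d, kap)] is
    encoded by [r + d * k]. *)
Let idx_eq (d l d' l' r r' : nat) : (l <= N)%N -> (l' <= N)%N ->
  (idx d l r == idx d' l' r') = [&& r + d * k == r' + d' * k & l == l']%N.
Proof.
move=> lN lN'; apply/eqP/andP => [|[/eqP e /eqP <-]].
  case/(coef_idx_inj (ltnW km) _ _ lN lN'); rewrite ?ltn_mod // => e1 e2 ->.
  split=> //; rewrite (divn_eq r k) (divn_eq r' k) e2.
  by rewrite -!addnA ![(_ %% k + _)%N]addnC !addnA -!mulnDl e1.
have := congr1 (modn^~ k) e; have := congr1 (divn^~ k) e.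
rewrite /= ![(_ + _ * k)%N]addnC !divnMDl // !modnMDl /idx.
by rewrite ![(_ + _ %/ _)%N]addnC => -> ->.
Qed.

Let W := \sum_(i < N) pbar p (lift ord0 i) 1 *: M (idx 0 i.+1).

Lemma constraint_mx_select :
  constraint_mx k m n t p = h *: (W + (M (idx 0 0) - M (idx 1 0))).
Proof.
apply/matrixP => r q; have rn := row_lt r.
rewrite mxE [LHS]mxE /W [RHS]mxE [in RHS]mxE summxE.
(* The point [t j.+1] is the right end of subinterval [j], local coordinate 1, and the left end of
   the next one, local coordinate 0, where only [l = 0] survives. *)
have right l : pbar_sub t p (r %/ k) l (t (r %/ k).+1) = h * pbar p l 1.
  by rewrite /pbar_sub -/(stepsize t _) hequi ?divff ?gt_eqF //; lia.
have left l : pbar_sub t p (r %/ k).+1 l (t (r %/ k).+1) = h * (l == ord0)%:R.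
  by rewrite /pbar_sub subrr mul0r pbar_at0 hequi //; lia.
rewrite (eq_bigr _ (fun l _ => congr1 (GRing.mul _) (right l))).
rewrite (eq_bigr _ (fun l _ => congr1 (GRing.mul _) (left l))).
rewrite [X in _ - X](bigD1 ord0) //= [X in _ - (_ + X)]big1 ?addr0; last first.
  by move=> l /negPf ->; rewrite !mulr0.
rewrite /= mulr1 big_ord_recl {1}/pbar unlift_none mulr1 !coef_delta.
rewrite !mxE /idx addn0 addn1 mulrDr mulrBr mulr_sumr.
rewrite addrAC [RHS]addrC; congr (_ + _).
  by rewrite -mulrBl -mulrBr mulrC.
by apply: eq_bigr => i _; rewrite coef_delta !mxE addn0 lift0; ring.
Qed.

(** For [l = l'] and [d <> d'] the product can be nonzero, since adjacent jumps share a subinterval.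
    This is why [F - E] is only estimated. *)
Let gram (d l d' l' : nat) : (d <= 1)%N -> (l <= N)%N -> (l' <= N)%N ->
  M (idx d l) *m (M (idx d' l'))^T =
  \matrix_(r, r') [&& r + d * k == r' + d' * k & l == l']%N%:R.
Proof.
move=> d1 lN lN'; apply/matrixP => r r'.
by rewrite select_mx_mul_tr ?idx_lt // idx_eq // mxE.
Qed.

Let gram1 (d l : nat) : (d <= 1)%N -> (l <= N)%N ->
  M (idx d l) *m (M (idx d l))^T = 1%:M.
Proof.
move=> d1 lN; rewrite gram //; apply/matrixP => r r'.
by rewrite !mxE eqn_add2r eqxx andbT.
Qed.

Let gram0 (d l d' l' : nat) : (d <= 1)%N -> (l <= N)%N -> (l' <= N)%N ->
  l != l' -> M (idx d l) *m (M (idx d' l'))^T = 0.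
Proof.
move=> d1 lN lN' /negPf ll; rewrite gram //; apply/matrixP => r r'.
by rewrite !mxE ll andbF.
Qed.

Let gramWW : W *m W^T = (pbar_sqsum p)%:M.
Proof.
rewrite /W linear_sum mulmx_suml -scalemx1 /pbar_sqsum scaler_suml.
apply: eq_bigr => i _; rewrite mulmx_sumr (bigD1 i) //= big1 ?addr0.
  rewrite linearZ -scalemxAl -scalemxAr scalerA gram1 ?ltn_ord //.
  by rewrite /pbar liftK expr2.
move=> i' ii'; rewrite linearZ -scalemxAl -scalemxAr gram0 ?ltn_ord ?scaler0 //.
by rewrite eqSS -val_eqE eq_sym in ii' *.
Qed.

Let gramMW (d : nat) : (d <= 1)%N -> M (idx d 0) *m W^T = 0.
Proof.
move=> d1; rewrite /W linear_sum mulmx_sumr big1 // => i _.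
by rewrite linearZ -scalemxAr gram0 ?ltn_ord ?scaler0.
Qed.

Lemma sqnorm_constraint_tr (y : 'cV[R]_(k * (n - 1))) :
  h ^+ 2 * pbar_sqsum p * sqnorm y <=
  sqnorm ((constraint_mx k m n t p)^T *m y) <=
  h ^+ 2 * (pbar_sqsum p + 4) * sqnorm y.
Proof.
set F := M (idx 0 0); set E := M (idx 1 0).
have -> : sqnorm ((constraint_mx k m n t p)^T *m y) =
    h ^+ 2 * (pbar_sqsum p * sqnorm y + sqnorm ((F - E)^T *m y)).
  rewrite constraint_mx_select linearZ -scalemxAl sqnormZ linearD mulmxDl.
  rewrite sqnormD (sqnorm_tr_mulmx _ gramWW).
  (* The cross term is [y^T W (F - E)^T y], and [W (F - E)^T] is the transpose of
     [(F - E) W^T = 0]. *)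
  rewrite trmx_mul trmxK -mulmxA (mulmxA W) -[W *m _]trmxK trmx_mul trmxK.
  by rewrite mulmxBl !gramMW // subrr trmx0 mul0mx mulmx0 mxE mulr0 addr0.
have FE : sqnorm ((F - E)^T *m y) + sqnorm ((F + E)^T *m y) = 4 * sqnorm y.
  have F1 : sqnorm (F^T *m y) = sqnorm y.
    by rewrite (@sqnorm_tr_mulmx _ _ _ _ 1) ?gram1 // mul1r.
  have E1 : sqnorm (E^T *m y) = sqnorm y.
    by rewrite (@sqnorm_tr_mulmx _ _ _ _ 1) ?gram1 // mul1r.
  by rewrite linearB linearD mulmxBl mulmxDl sqnorm_parallelogram F1 E1; ring.
have h2 : 0 <= h ^+ 2 by rewrite sqr_ge0.
(* The square with [F - E] being nonnegative gives the lower bound; the one with [F + E], through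
   [FE], gives the upper bound. *)
have := sqnorm_ge0 ((F + E)^T *m y); have := sqnorm_ge0 ((F - E)^T *m y).
by move=> ? ?; apply/andP; split; rewrite -mulrA ler_wpM2l //; lra.
Qed.

End ConstraintMatrix.

Lemma constraint_bounds (R : realType) (k m N n : nat) (h s0 : R)
    (t : nat -> R) (p : 'I_N -> {poly R}) :
  (0 < k)%N -> (k < m)%N -> 0 < h ->
  (forall j, (j < n)%N -> stepsize t j = h) ->
  0 < s0 <= pbar_sqsum p ->
  let C := constraint_mx k m n t p in
  cond_number C <= Num.sqrt (1 + 4 / s0) /\
  spectral_norm (moore_penrose C) <= Num.sqrt s0^-1 * h^-1.
Proof.
move=> k0 km h0 th sp; apply: (cond_number_bounds (h0) sp) => y.
exact: sqnorm_constraint_tr.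
Qed.

(** * Integrals and endpoint values of polynomials, and two elementary inequalities *)

Lemma Rintegral_poly (R : realType) (p : {poly R}) (a b : R) : a < b ->
  \int[lebesgue_measure]_(s in `[a, b]) (p^`()).[s] = p.[b] - p.[a].
Proof.
move=> ab.
rewrite /Rintegral (@continuous_FTC2 _ (horner p^`()) (horner p)) //.
- by apply: continuous_subspaceT => x; exact: continuous_horner.
- split.
  + by move=> x _.
  + by apply: cvg_at_right_filter; exact: continuous_horner.
  + by apply: cvg_at_left_filter; exact: continuous_horner.
- by move=> x _; rewrite derive1E derive_val.
Qed.

Lemma poly_antiderivative (R : numFieldType) (p : {poly R}) :
  exists q : {poly R}, q^`() = p.
Proof.
exists (\sum_(i < size p) (p`_i / i.+1%:R) *: 'X^(i.+1)).
rewrite raddf_sum /= -[RHS]coefK poly_def; apply: eq_bigr => i _.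
by rewrite derivZ derivXn /= -scalerMnr scalerMnl -mulr_natr divfK // pnatr_eq0.
Qed.

(** Passing to antiderivatives reduces additivity of the integral to additivity of evaluation,
    without integrability conditions. *)
Lemma Rintegral_poly_sum (R : realType) (I : Type) (r : seq I)
    (p : I -> {poly R}) (a b : R) : a < b ->
  \int[lebesgue_measure]_(s in `[a, b]) (\sum_(i <- r) p i).[s] =
  \sum_(i <- r) \int[lebesgue_measure]_(s in `[a, b]) (p i).[s].
Proof.
move=> ab; elim: r => [|i r IHr].
  by rewrite !big_nil -(deriv0 R) Rintegral_poly // !horner0 subrr.
rewrite !big_cons -IHr.
have [P <-] := poly_antiderivative (p i).
have [Q <-] := poly_antiderivative (\sum_(j <- r) p j).
by rewrite -derivD !Rintegral_poly // !hornerE /=; ring.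
Qed.

Lemma Rintegral_poly1 (R : realType) :
  \int[lebesgue_measure]_(s in `[0, 1]) (1 : {poly R}).[s] = 1.
Proof. by rewrite -derivX Rintegral_poly // !hornerX subr0. Qed.

(** One differentiation of [(X - c)^(n+1) q] leaves [(X - c)^n] times a polynomial with value
    [(n + 1) q(c)] at [c]. *)
Lemma horner_derivn_root_pow (R : comNzRingType) (c : R) (n : nat)
    (q : {poly R}) :
  ((('X - c%:P) ^+ n * q)^`(n)).[c] = n`!%:R * q.[c].
Proof.
elim: n q => [|n IHn] q; first by rewrite derivn0 expr0 !mul1r.
rewrite derivSn.
have -> : (('X - c%:P) ^+ n.+1 * q)^`() =
          ('X - c%:P) ^+ n * (q *+ n.+1 + ('X - c%:P) * q^`()).
  rewrite derivM deriv_exp /= derivB derivX derivC subr0 mul1r exprS.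
  by rewrite mulrnAl -mulrnAr; ring.
by rewrite IHn !hornerE hornerMn factS natrM -mulr_natr; ring.
Qed.

(** In Rodrigues' formula the factor [(X + 1)^i] absorbs all [i] derivatives at -1, leaving
    [(-2)^i / 2^i]. *)
Lemma legendre_atN1 (R : realType) (i : nat) :
  (legendre R i).[-1] = (-1) ^+ i.
Proof.
have X21 : 'X ^+ 2 - 1 = ('X - (-1)%:P) * ('X - 1) :> {poly R}.
  by rewrite polyCN; ring.
rewrite /legendre X21 exprMn hornerZ horner_derivn_root_pow horner_exp !hornerE.
rewrite /=; have -> : -1 - 1 = -1 * 2 :> R by ring.
rewrite exprMn [_ * (_ * _)]mulrA invfM; field.
by rewrite expf_neq0 ?pnatr_eq0 -?lt0n ?fact_gt0.
Qed.

(** The difference of the two sides has degree below [N] and vanishes at [N] distinct nodes. *)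
Lemma sum_runge_kutta_basis (R : realType) (N : nat) (tau : 'I_N -> R) :
  (0 < N)%N -> injective tau -> \sum_i runge_kutta_basis tau i = 1.
Proof.
move=> N0 tau_inj; apply/eqP; rewrite -subr_eq0; apply/eqP.
apply: (@roots_geq_poly_eq0 _ _ [seq tau i | i <- enum 'I_N]).
- apply/allP => _ /mapP[j _ ->]; rewrite rootE !hornerE horner_sum.
  rewrite (bigD1 j) //= big1 ?addr0 => [|i ij].
    rewrite /runge_kutta_basis horner_prod big1 ?subrr // => l lj.
    by rewrite !hornerE mulVf // subr_eq0 (inj_eq tau_inj) eq_sym.
  rewrite /runge_kutta_basis horner_prod (bigD1 j) /= 1?eq_sym //.
  by rewrite !hornerE subrr mulr0 mul0r.
- by rewrite map_inj_uniq ?enum_uniq.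
rewrite size_map size_enum_ord.
apply: (leq_trans (size_polyD _ _)); rewrite geq_max size_polyN size_poly1 N0.
rewrite andbT; apply: (leq_trans (size_sum _ _ _)); apply/bigmax_leqP => i _.
rewrite /runge_kutta_basis scaler_prod; apply: (leq_trans (size_scale_leq _ _)).
apply: (leq_trans (size_poly_prod_leq _ _)).
under eq_bigr do rewrite size_XsubC.
by rewrite sum_nat_const cardC1 card_ord; lia.
Qed.

(** Cauchy-Schwarz against the all-ones vector, read off from the squares of the deviations
    [N x_i - S]. *)
Lemma sqr_sum_le (R : realFieldType) (N : nat) (x : 'I_N -> R) :
  (\sum_i x i) ^+ 2 <= N%:R * \sum_i x i ^+ 2.
Proof.
case: N x => [|N] x; first by rewrite !big_ord0 expr0n mul0r.
set S := \sum_i x i; set Q := \sum_i x i ^+ 2.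
have : 0 <= \sum_i (N.+1%:R * x i - S) ^+ 2.
  by apply: sumr_ge0 => i _; rewrite sqr_ge0.
have -> : \sum_i (N.+1%:R * x i - S) ^+ 2 = N.+1%:R * (N.+1%:R * Q - S ^+ 2).
  transitivity (\sum_i (N.+1%:R ^+ 2 * x i ^+ 2 - 2 * N.+1%:R * S * x i
                         + S ^+ 2)).
    by apply: eq_bigr => i _; ring.
  rewrite big_split sumrB -!mulr_sumr -/S -/Q sumr_const card_ord /=.
  by rewrite -mulr_natl; ring.
by rewrite pmulr_rge0 ?ltr0Sn // subr_ge0.
Qed.

(** From [1 - 1/2 <= exp (-1/2)], that is [exp (1/2) <= 2]. *)
Lemma ln2_ge_half (R : realType) : 1 / 2 <= ln 2 :> R.
Proof.
rewrite -ler_expR lnK ?posrE //.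
have := expR_ge1Dx (- (1 / 2) : R); rewrite expRN.
have e0 := expR_gt0 (1 / 2 : R).
have -> : 1 + - (1 / 2) = 2^-1 :> R by field.
by rewrite lef_pV2 ?posrE ?ltr0n.
Qed.

(** * Lower bounds on [pbar_sqsum] for the four bases *)

Lemma pbar_sqsum_ge1 (R : realType) (N : nat) (p : 'I_N -> {poly R})
    (i : 'I_N) :
  p i = 1 -> 1 <= pbar_sqsum p.
Proof.
move=> pi1; rewrite /pbar_sqsum (bigD1 i) //= pi1 Rintegral_poly1 expr1n.
by rewrite lerDl sumr_ge0 // => j _; rewrite sqr_ge0.
Qed.

Lemma legendre_pbar_sqsum_ge (R : realType) (N : nat) : (0 < N)%N ->
  1 <= pbar_sqsum (@legendre_basis R N).
Proof.
move=> N0; apply: (@pbar_sqsum_ge1 _ _ _ (Ordinal N0)).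
rewrite /legendre_basis /legendre derivn0 /= expr0 fact0 mulr1 invr1 scale1r.
by rewrite -polyC1 comp_polyC.
Qed.

Lemma chebyshev_pbar_sqsum_ge (R : realType) (N : nat) : (0 < N)%N ->
  1 <= pbar_sqsum (@chebyshev_basis R N).
Proof.
move=> N0; apply: (@pbar_sqsum_ge1 _ _ _ (Ordinal N0)).
by rewrite /chebyshev_basis /= -polyC1 comp_polyC.
Qed.

(** The [i]-th integral is [1 - (-1)^(i+1)]: 2 for even [i], 0 for odd [i]. At least half of the
    indices below [N] are even. *)
Lemma modified_legendre_pbar_sqsum_ge (R : realType) (N : nat) :
  (2 * N)%:R <= pbar_sqsum (@modified_legendre_basis R N).
Proof.
have -> : pbar_sqsum (@modified_legendre_basis R N) =
    \sum_(i < N) (4 * ~~ odd i)%N%:R.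
  apply: eq_bigr => i _; rewrite /modified_legendre_basis Rintegral_poly //.
  have s1 : (shift01 R).[1] = 1 by rewrite !hornerE; ring.
  have s0 : (shift01 R).[0] = -1 by rewrite !hornerE; ring.
  rewrite !hornerD !hornerN !hornerC !horner_comp s1 s0.
  rewrite legendre_at1 legendre_atN1 -signr_odd /=.
  by case: odd; rewrite /= ?expr0 ?expr1 ?muln0 ?muln1; ring.
rewrite -natr_sum ler_nat.
(* The summand [2 * odd M] makes the induction work: a step adds 4 or 0, alternately, instead of
   2. *)
have E : forall M, (2 * M + 2 * odd M <= \sum_(i < M) 4 * ~~ odd i)%N.
  elim=> [|M IHM]; first by rewrite big_ord0.
  by rewrite big_ord_recr /=; case: odd IHM => /=; lia.
by apply: leq_trans (E N); rewrite leq_addr.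
Qed.

(** The basis sums to 1, hence so do its integrals; Cauchy-Schwarz bounds the sum of their
    squares. *)
Lemma runge_kutta_pbar_sqsum_ge (R : realType) (N : nat) (tau : 'I_N -> R) :
  (0 < N)%N -> injective tau -> N%:R^-1 <= pbar_sqsum (runge_kutta_basis tau).
Proof.
move=> N0 tau_inj; rewrite -[leLHS]mulr1 ler_pdivrMl ?ltr0n //.
apply: le_trans (sqr_sum_le _).
rewrite -Rintegral_poly_sum // sum_runge_kutta_basis //.
by rewrite Rintegral_poly1 expr1n.
Qed.

Unset Implicit Arguments.
Set Strict Implicit.

Theorem corollary1 (R : realType) (k m N n : nat)
    (hk : (0 < k)%N) (hkm : (k < m)%N) (hN : (1 <= N)%N) (hn : (2 <= n)%N)
    (a b h : R) (t : nat -> R)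
    (ht0 : t 0%N = a) (htn : t n = b)
    (hgrid : forall j : nat, (j < n)%N -> t j < t j.+1)
    (hequi : forall j : nat, (j < n)%N -> stepsize t j = h) :
  [/\ (let C := constraint_mx k m n t (@legendre_basis R N) in
       cond_number C <= Num.sqrt 5
       /\ spectral_norm (moore_penrose C) <= h^-1),
      (let C := constraint_mx k m n t (@modified_legendre_basis R N) in
       cond_number C <= Num.sqrt ((2 * N + 6)%:R / (2 * N)%:R)
       /\ spectral_norm (moore_penrose C)
          <= (Num.sqrt (2 * N)%:R)^-1 * h^-1),
      (let C := constraint_mx k m n t (@chebyshev_basis R N) in
       cond_number C <= Num.sqrt (4 + 2 * ln 2)
       /\ spectral_norm (moore_penrose C) <= h^-1)
    & (forall tau : 'I_N -> R,
       (forall i : 'I_N, 0 < tau i < 1) ->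
       (forall i j : 'I_N, (i < j)%N -> tau i < tau j) ->
       (forall i : 'I_N,
          0 <= \int[lebesgue_measure]_(s in `[0, 1])
                 (runge_kutta_basis tau i).[s]) ->
       let C := constraint_mx k m n t (runge_kutta_basis tau) in
       cond_number C <= Num.sqrt (5 * N)%:R
       /\ spectral_norm (moore_penrose C) <= Num.sqrt N%:R * h^-1)].
Proof.
have n0 : (0 < n)%N by apply: leq_trans hn.
have N0 : 0 < N%:R :> R by rewrite ltr0n.
have h0 : 0 < h by rewrite -(hequi 0%N n0) subr_gt0; exact: hgrid.
(* With [s0] equal to 1, [2 N], 1 and [1 / N] in turn, [1 + 4 / s0] is 5, [1 + 4 / (2 N)], 5 and
   [1 + 4 N]. *)
have bounds := constraint_bounds hk hkm h0 hequi.
have sqrt_le (x y : R) : x <= y -> Num.sqrt x <= Num.sqrt y by exact: ler_wsqrtr.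
split.
- have [|kC nC] := bounds N 1 (@legendre_basis R N).
    by rewrite ltr01 legendre_pbar_sqsum_ge.
  split; first by apply: le_trans kC _; apply: sqrt_le; lra.
  by move: nC; rewrite invr1 sqrtr1 mul1r.
- have N20 : 0 < (2 * N)%:R :> R by rewrite natrM mulr_gt0.
  have [|kC nC] := bounds N (2 * N)%:R (@modified_legendre_basis R N).
    by rewrite N20 modified_legendre_pbar_sqsum_ge.
  split; last by rewrite -sqrtrV ?(ltW N20).
  apply: le_trans kC _; apply: sqrt_le.
  have -> : (2 * N + 6)%:R / (2 * N)%:R = 1 + 6 / (2 * N)%:R :> R.
    by rewrite natrD; field; rewrite gt_eqF.
  by rewrite lerD2l ler_pM2r ?invr_gt0 // ler_nat.
- have [|kC nC] := bounds N 1 (@chebyshev_basis R N).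
    by rewrite ltr01 chebyshev_pbar_sqsum_ge.
  split; last by move: nC; rewrite invr1 sqrtr1 mul1r.
  apply: le_trans kC _; apply: sqrt_le.
  (* [5 <= 4 + 2 ln 2] amounts to [ln 2 >= 1/2]. *)
  by have := ln2_ge_half R; lra.
- move=> tau _ tau_lt _.
  have tau_inj : injective tau.
    move=> i j tauij; apply/val_inj/eqP; case: ltngtP => //= /tau_lt.
      by rewrite tauij ltxx.
    by rewrite tauij ltxx.
  have [|kC nC] := bounds N N%:R^-1 (runge_kutta_basis tau).
    by rewrite invr_gt0 N0 runge_kutta_pbar_sqsum_ge.
  rewrite invrK in kC nC; split=> //.
  apply: le_trans kC _; apply: sqrt_le.
  (* Absorbs the constant: [1 + 4 N <= 5 N]. *)
  have N1 : 1 <= N%:R :> R by rewrite ler1n.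
  by rewrite natrM; lra.
Qed.
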